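(* Let $(V,|0\rangle,T,Y,\mathcal{S})$ be a braided state-field correspondence and let $a,b\in V$. Then: (a) $a_{(\lambda,z^mf)}b=\partial_\lambda^m\,a_{(\lambda,f)}b$ for all $m\ge0$ and $f\in\mathbb{K}((z))[[h]]$. In particular, $a_{(\lambda,z^m)}b=\partial_\lambda^m\,a_{(\lambda,1)}b$ for $m\ge0$. (b) $a_{(\lambda,z^{-k})}b=\big((\lambda+T)^{(k-1)}a\big)_{(\lambda,z^{-1})}b$ for all $k\ge1$.
   Context: $\mathbb{K}$ is a field of characteristic zero. A topologically free $\mathbb{K}[[h]]$-module is one isomorphic to $W[[h]]$ for a $\mathbb{K}$-vector space $W$; $U[[h]]\hat\otimes W[[h]]:=(U\otimes W)[[h]]$. $V_h((z))$ is the set of $a(z)\in V[[z,z^{-1}]]$ such that $a(z)\in V((z))$ modulo $h^M$ for every $M\ge0$. $\mathrm{Res}_z$ is the coefficient of $z^{-1}$. A braided state-field correspondence $(V,|0\rangle,T,Y,\mathcal{S})$ consists of: a topologically free $\mathbb{K}[[h]]$-module $V$ with a nonzero vector $|0\rangle$ and a $\mathbb{K}[[h]]$-linear $T:V\to V$ with $T|0\rangle=0$; a $\mathbb{K}[[h]]$-linear map $Y:V\hat\otimes V\to V_h((z))$, written $Y(z)(a\otimes b)=Y(a,z)b=\sum_{n\in\mathbb{Z}}a_{(n)}b\,z^{-n-1}$, with $Y(z)(|0\rangle\otimes v)=v$, $Y(z)(v\otimes|0\rangle)\in v+V[[z]]z$ for all $v\in V$, and $\partial_zY(z)=TY(z)-Y(z)(1\otimes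 T)=Y(z)(T\otimes1)$; and a braiding, i.e. a $\mathbb{K}[[h]]$-linear map $\mathcal{S}(z):V\hat\otimes V\to V\hat\otimes V\hat\otimes(\mathbb{K}((z))[[h]])$ with $\mathcal{S}=1+O(h)$. For $f\in\mathbb{K}((z))[[h]]$ the $(\lambda,f)$-product is $a_{(\lambda,f)}b=\mathrm{Res}_z\,e^{\lambda z}f(z)Y(z)(a\otimes b)$, with values in $V\otimes\mathbb{K}[\lambda][[h]]$ ($h$-adically completed: polynomial in $\lambda$ with coefficients in $V$ modulo each $h^M$), extended linearly over polynomials in $\lambda$. Divided powers: $X^{(n)}=X^n/n!$; thus $(\lambda+T)^{(k-1)}a=\frac{1}{(k-1)!}(\lambda+T)^{k-1}a$. *)

(* Defs.v *)
From HB Require Import structures.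
From mathcomp Require Import all_boot all_order all_algebra.
From mathcomp Require Import boolp classical_sets functions cardinality fsbigop.
From mathcomp Require Import zify.

Set Implicit Arguments.
Unset Strict Implicit.
Unset Printing Implicit Defensive.

Import Order.TTheory GRing.Theory Num.Theory.
Local Open Scope ring_scope.

(** [hser W] is W[[h]]; it is a ring when [W] is one, and a module over
    K[[h]] = [hser K] when [W] is a vector space over [K]. *)
Record hser (W : Type) := HSer { hcoef : nat -> W }.

HB.instance Definition _ (W : Type) := gen_eqMixin (hser W).
HB.instance Definition _ (W : Type) := gen_choiceMixin (hser W).

Lemma hserP (W : Type) (x y : hser W) :
  (forall n, hcoef x n = hcoef y n) -> x = y.
Proof. by case: x y => [f] [g] /= /funext ->. Qed.

Section HserZmod.
Variable W : zmodType.

Definition hser_zero : hser W := HSer (fun=> 0).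
Definition hser_opp (x : hser W) := HSer (fun n => - hcoef x n).
Definition hser_add (x y : hser W) := HSer (fun n => hcoef x n + hcoef y n).

Lemma hser_addA : associative hser_add.
Proof. by move=> x y z; apply: hserP => n /=; rewrite addrA. Qed.
Lemma hser_addC : commutative hser_add.
Proof. by move=> x y; apply: hserP => n /=; rewrite addrC. Qed.
Lemma hser_add0 : left_id hser_zero hser_add.
Proof. by move=> x; apply: hserP => n /=; rewrite add0r. Qed.
Lemma hser_addN : left_inverse hser_zero hser_opp hser_add.
Proof. by move=> x; apply: hserP => n /=; rewrite addNr. Qed.

HB.instance Definition _ := GRing.isZmodule.Build (hser W)
  hser_addA hser_addC hser_add0 hser_addN.

Lemma hcoef0 n : hcoef (0 : hser W) n = 0. Proof. by []. Qed.
Lemma hcoefD (x y : hser W) n : hcoef (x + y) n = hcoef x n + hcoef y n.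
Proof. by []. Qed.
Lemma hcoefN (x : hser W) n : hcoef (- x) n = - hcoef x n. Proof. by []. Qed.
Lemma hcoefB (x y : hser W) n : hcoef (x - y) n = hcoef x n - hcoef y n.
Proof. by []. Qed.
Lemma hcoef_sum I (r : seq I) (P : pred I) (F : I -> hser W) n :
  hcoef (\sum_(i <- r | P i) F i) n = \sum_(i <- r | P i) hcoef (F i) n.
Proof. by elim/big_rec2: _ => // i x y _ <-. Qed.

End HserZmod.

Definition hconst (W : zmodType) (w : W) : hser W :=
  HSer (fun n => if n is 0 then w else 0).

Lemma sum_triangle (Z : zmodType) (F : nat -> nat -> nat -> Z) n :
  \sum_(i < n.+1) \sum_(j < i.+1) F j (i - j)%N (n - i)%N
  = \sum_(j < n.+1) \sum_(k < (n - j).+1) F j k (n - j - k)%N.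
Proof.
pose G i j := F j (i - j)%N (n - i)%N.
transitivity (\sum_(i < n.+1) \sum_(j < n.+1 | (j <= i)%N) G i j).
  apply: eq_bigr => i _.
  rewrite (big_ord_widen_cond n.+1 xpredT (fun j => G i j)) ?ltn_ord //.
rewrite (exchange_big_dep xpredT) //=; apply: eq_bigr => j _.
have le_jn : (j <= n)%N by rewrite -ltnS.
rewrite -(big_mkord (fun i => j <= i)%N (fun i => G i j)).
rewrite (big_cat_nat (n := j)) //=; last exact: ltnW.
rewrite big_nat_cond big_pred0 ?add0r; last first.
  by move=> i; case: (ltnP i j).
rewrite big_nat_cond.
rewrite (eq_bigl (fun i => (j <= i < n.+1)%N && true)); last first.
  by move=> i; case: (leqP j i); rewrite ?andbT ?andbF.
rewrite -big_nat_cond -[X in index_iota X _]add0n big_addn subSn // big_mkord.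
by apply: eq_bigr => k _; rewrite /G addnK addnC subnDA.
Qed.

Section HserRing.
Variable R : comNzRingType.

Definition hser_one : hser R := hconst 1.
Definition hser_mul (x y : hser R) :=
  HSer (fun n => \sum_(i < n.+1) hcoef x i * hcoef y (n - i)%N).

Lemma hser_mulA : associative hser_mul.
Proof.
move=> x y z; apply: hserP => n /=.
under eq_bigr do rewrite mulr_sumr; under [RHS]eq_bigr do rewrite mulr_suml.
rewrite (sum_triangle (fun i j k => hcoef x i * hcoef y j * hcoef z k)).
by apply: eq_bigr => i _; apply: eq_bigr => j _; rewrite mulrA.
Qed.
Lemma hser_mulC : commutative hser_mul.
Proof.
move=> x y; apply: hserP => n /=; rewrite (reindex_inj rev_ord_inj) /=.
by apply: eq_bigr => i _; rewrite subSS subKn -1?ltnS // mulrC.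
Qed.
Lemma hser_mul1 : left_id hser_one hser_mul.
Proof.
move=> x; apply: hserP => n /=.
by rewrite big_ord_recl /= mul1r subn0 big1 ?addr0 // => i _; rewrite mul0r.
Qed.
Lemma hser_mulDl : left_distributive hser_mul +%R.
Proof.
move=> x y z; apply: hserP => n /=; rewrite -big_split /=.
by apply: eq_bigr => i _; rewrite mulrDl.
Qed.
Lemma hser_one_neq0 : hser_one != 0.
Proof.
by apply/eqP => /(congr1 (fun x => hcoef x 0)) /= /eqP; rewrite oner_eq0.
Qed.

HB.instance Definition _ := GRing.Zmodule_isComNzRing.Build (hser R)
  hser_mulA hser_mulC hser_mul1 hser_mulDl hser_one_neq0.

Definition hvar : hser R := HSer (fun n => (n == 1%N)%:R).

End HserRing.
Arguments hvar {R}.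

Section HserLmod.
Variables (K : comNzRingType) (W : lmodType K).

Definition hser_scale (c : hser K) (x : hser W) :=
  HSer (fun n => \sum_(i < n.+1) hcoef c i *: hcoef x (n - i)%N).

Lemma hser_scaleA c d x :
  hser_scale c (hser_scale d x) = hser_scale (c * d) x.
Proof.
apply: hserP => n /=.
under eq_bigr do rewrite scaler_sumr; under [RHS]eq_bigr do rewrite scaler_suml.
rewrite (sum_triangle (fun i j k => (hcoef c i * hcoef d j) *: hcoef x k)).
by apply: eq_bigr => i _; apply: eq_bigr => j _; rewrite scalerA.
Qed.
Lemma hser_scale1 : left_id 1 hser_scale.
Proof.
move=> x; apply: hserP => n /=.
by rewrite big_ord_recl /= scale1r subn0 big1 ?addr0 // => i _; rewrite scale0r.
Qed.
Lemma hser_scaleDr : right_distributive hser_scale +%R.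
Proof.
move=> c x y; apply: hserP => n /=; rewrite -big_split /=.
by apply: eq_bigr => i _; rewrite scalerDr.
Qed.
Lemma hser_scaleDl x : {morph hser_scale^~ x : c d / c + d}.
Proof.
move=> c d; apply: hserP => n /=; rewrite -big_split /=.
by apply: eq_bigr => i _; rewrite scalerDl.
Qed.

HB.instance Definition _ := GRing.Zmodule_isLmodule.Build (hser K) (hser W)
  hser_scaleA hser_scale1 hser_scaleDr hser_scaleDl.

Lemma hcoefZ (c : hser K) (x : hser W) n :
  hcoef (c *: x) n = \sum_(i < n.+1) hcoef c i *: hcoef x (n - i)%N.
Proof. by []. Qed.

End HserLmod.

Section Tensor.
Variables (K : fieldType) (W U : lmodType K).

(** Finite sums of pure tensors, modulo the congruence generated by
    bilinearity. *)
Inductive tens_rel : seq (W * U) -> seq (W * U) -> Prop :=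
| TRrefl s : tens_rel s s
| TRsym s t : tens_rel s t -> tens_rel t s
| TRtrans s t r : tens_rel s t -> tens_rel t r -> tens_rel s r
| TRcat s s' t t' : tens_rel s s' -> tens_rel t t' ->
    tens_rel (s ++ t) (s' ++ t')
| TRcatC s t : tens_rel (s ++ t) (t ++ s)
| TR0 u : tens_rel [:: (0, u)] [::]
| TRDl w w' u : tens_rel [:: (w + w', u)] [:: (w, u); (w', u)]
| TRDr w u u' : tens_rel [:: (w, u + u')] [:: (w, u); (w, u')]
| TRZ k w u : tens_rel [:: (k *: w, u)] [:: (w, k *: u)].

Definition tens_eqb (s t : seq (W * U)) : bool := `[< tens_rel s t >].

Lemma tens_eqb_refl : reflexive tens_eqb.
Proof. by move=> s; apply/asboolP; constructor. Qed.
Lemma tens_eqb_sym : symmetric tens_eqb.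
Proof. by move=> s t; apply/asboolP/asboolP; apply: TRsym. Qed.
Lemma tens_eqb_trans : transitive tens_eqb.
Proof.
by move=> t s r /asboolP st /asboolP tr; apply/asboolP; apply: TRtrans tr.
Qed.

Canonical tens_equiv := EquivRel tens_eqb
  tens_eqb_refl tens_eqb_sym tens_eqb_trans.

Definition tensor := {eq_quot tens_equiv}%qT.
HB.instance Definition _ := Choice.on tensor.

Definition tclass (s : seq (W * U)) : tensor := (\pi_(tensor) s)%qT.

Lemma tclassP s t : tclass s = tclass t <-> tens_rel s t.
Proof. by split=> [/eqquotP/asboolP|st]; last apply/eqquotP/asboolP. Qed.

Lemma tclassK (x : tensor) : tclass (repr x) = x.
Proof. exact: reprK. Qed.

Lemma tclass_repr s : tens_rel (repr (tclass s)) s.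
Proof. by apply/tclassP; rewrite tclassK. Qed.

Definition pure (w : W) (u : U) : tensor := tclass [:: (w, u)].

Definition tens_scale_seq (k : K) (s : seq (W * U)) :=
  [seq (k *: p.1, p.2) | p <- s].

Lemma tens_scale_rel k s t :
  tens_rel s t -> tens_rel (tens_scale_seq k s) (tens_scale_seq k t).
Proof.
elim=> {s t} /=; try by move=> *; constructor.
- by move=> s t r _ st _ tr; apply: TRtrans st tr.
- by move=> s s' t t' _ ss _ tt; rewrite /tens_scale_seq !map_cat; constructor.
- by move=> s t; rewrite /tens_scale_seq !map_cat; constructor.
- by move=> u; rewrite scaler0; constructor.
- by move=> w w' u; rewrite scalerDr; constructor.
- by move=> l w u; rewrite scalerA mulrC -scalerA; constructor.
Qed.

Definition tens_zero : tensor := tclass [::].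
Definition tens_add (x y : tensor) : tensor := tclass (repr x ++ repr y).
Definition tens_scale k (x : tensor) : tensor :=
  tclass (tens_scale_seq k (repr x)).
Definition tens_opp (x : tensor) : tensor := tens_scale (-1) x.

Lemma tclass_cat s t : tclass (s ++ t) = tens_add (tclass s) (tclass t).
Proof. by apply/tclassP; constructor; apply/TRsym/tclass_repr. Qed.

Lemma tclass_scale k s : tclass (tens_scale_seq k s) = tens_scale k (tclass s).
Proof. by apply/tclassP/tens_scale_rel/TRsym/tclass_repr. Qed.

Lemma tens_addA : associative tens_add.
Proof.
move=> x y z; rewrite -(tclassK x) -(tclassK y) -(tclassK z).
by rewrite -!tclass_cat catA.
Qed.
Lemma tens_addC : commutative tens_add.
Proof. by move=> x y; apply/tclassP; constructor. Qed.
Lemma tens_add0 : left_id tens_zero tens_add.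
Proof. by move=> x; rewrite -(tclassK x) -tclass_cat. Qed.

Lemma tens_scale0_rel s : tens_rel (tens_scale_seq 0 s) [::].
Proof.
elim: s => [|[w u] s IHs] /=; first exact: TRrefl.
rewrite scale0r -[X in tens_rel X]/([:: (0, u)] ++ tens_scale_seq 0 s).
by rewrite -[[::]]/([::] ++ [::] : seq (W * U)); apply: TRcat => //; constructor.
Qed.

Lemma tens_scaleDl_rel k l s :
  tens_rel (tens_scale_seq (k + l) s) (tens_scale_seq k s ++ tens_scale_seq l s).
Proof.
apply/tclassP; elim: s => [|[w u] s IHs] //=; rewrite scalerDl.
have catE (p : W * U) t : tclass (p :: t) = tens_add (tclass [:: p]) (tclass t).
  by rewrite -tclass_cat.
rewrite catE IHs [RHS]catE !tclass_cat [tclass (_ :: tens_scale_seq l s)]catE.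
have -> : tclass [:: (k *: w + l *: w, u)]
  = tens_add (tclass [:: (k *: w, u)]) (tclass [:: (l *: w, u)]).
  by rewrite -tclass_cat; apply/tclassP/TRDl.
rewrite -!tens_addA; congr tens_add.
by rewrite !tens_addA (tens_addC (tclass [:: (l *: w, u)])).
Qed.

Lemma tens_addN : left_inverse tens_zero tens_opp tens_add.
Proof.
move=> x; rewrite -(tclassK x) /tens_opp -tclass_scale -tclass_cat.
apply/tclassP; set s := repr x.
have {2}-> : s = tens_scale_seq 1 s.
  by rewrite -[LHS]map_id; apply: eq_map => -[w u] /=; rewrite scale1r.
apply: TRtrans (tens_scale0_rel s); rewrite -(addNr 1).
exact/TRsym/tens_scaleDl_rel.
Qed.

HB.instance Definition _ := GRing.isZmodule.Build tensor
  tens_addA tens_addC tens_add0 tens_addN.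

Lemma tens_scaleA k l x : tens_scale k (tens_scale l x) = tens_scale (k * l) x.
Proof.
rewrite -(tclassK x) -!tclass_scale /tens_scale_seq -map_comp; congr tclass.
by apply: eq_map => -[w u] /=; rewrite scalerA.
Qed.
Lemma tens_scale1 : left_id 1 tens_scale.
Proof.
move=> x; rewrite -{2}(tclassK x); congr tclass.
by rewrite -[RHS]map_id; apply: eq_map => -[w u] /=; rewrite scale1r.
Qed.
Lemma tens_scaleDr : right_distributive tens_scale +%R.
Proof.
move=> k x y; rewrite -(tclassK x) -(tclassK y).
by rewrite -[LHS]/(tens_scale k (tens_add _ _)) -tclass_cat -!tclass_scale
  /tens_scale_seq map_cat tclass_cat.
Qed.
Lemma tens_scaleDl x : {morph tens_scale^~ x : k l / k + l}.
Proof.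
move=> k l; rewrite -(tclassK x) -!tclass_scale.
by rewrite -[RHS]tclass_cat; apply/tclassP/tens_scaleDl_rel.
Qed.

HB.instance Definition _ := GRing.Zmodule_isLmodule.Build K tensor
  tens_scaleA tens_scale1 tens_scaleDr tens_scaleDl.

Lemma pureDl w w' u : pure (w + w') u = pure w u + pure w' u.
Proof. by rewrite -[RHS]tclass_cat; apply/tclassP/TRDl. Qed.
Lemma pureDr w u u' : pure w (u + u') = pure w u + pure w u'.
Proof. by rewrite -[RHS]tclass_cat; apply/tclassP/TRDr. Qed.
Lemma pureZl k w u : pure (k *: w) u = k *: pure w u.
Proof. by rewrite -[RHS]tclass_scale. Qed.
Lemma pureZr k w u : pure w (k *: u) = k *: pure w u.
Proof. by rewrite -pureZl; apply/esym/tclassP/TRZ. Qed.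

Lemma tensor_pureE (x : tensor) : x = \sum_(p <- repr x) pure p.1 p.2.
Proof.
rewrite -[LHS]tclassK; elim: (repr x) => [|[w u] s IHs]; first by rewrite big_nil.
by rewrite big_cons -IHs -[RHS]tclass_cat.
Qed.

(** Universal property, for balanced biadditive maps into abelian groups. *)
Definition balanced (Z : zmodType) (B : W -> U -> Z) :=
  [/\ forall w w' u, B (w + w') u = B w u + B w' u,
      forall w u u', B w (u + u') = B w u + B w u'
    & forall k w u, B (k *: w) u = B w (k *: u)].

Definition tlift (Z : zmodType) (B : W -> U -> Z) (x : tensor) : Z :=
  \sum_(p <- repr x) B p.1 p.2.

Section Lift.
Variables (Z : zmodType) (B : W -> U -> Z).
Hypothesis balB : balanced B.

Lemma tlift_class s : tlift B (tclass s) = \sum_(p <- s) B p.1 p.2.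
Proof.
case: balB => BDl BDr BZ; rewrite /tlift.
have := tclass_repr s; move: (repr _) => t; elim=> {s t} //=.
- by move=> s t r _ -> _ ->.
- by move=> s s' t t' _ IHs _ IHt; rewrite !big_cat /= IHs IHt.
- by move=> s t; rewrite !big_cat /= addrC.
- move=> u; rewrite big_seq1 big_nil /=.
  by apply: (addrI (B 0 u)); rewrite -BDl !addr0.
- by move=> w w' u; rewrite big_seq1 big_cons big_seq1 /= BDl.
- by move=> w u u'; rewrite big_seq1 big_cons big_seq1 /= BDr.
- by move=> k w u; rewrite !big_seq1 /= BZ.
Qed.

Lemma tlift_pure w u : tlift B (pure w u) = B w u.
Proof. by rewrite tlift_class big_seq1. Qed.

Lemma tliftD x y : tlift B (x + y) = tlift B x + tlift B y.
Proof.
rewrite -(tclassK x) -(tclassK y).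
by rewrite -[tclass _ + _]tclass_cat !tlift_class big_cat.
Qed.

Lemma tlift_unique (g : tensor -> Z) : {morph g : x y / x + y} ->
  (forall w u, g (pure w u) = B w u) -> g =1 tlift B.
Proof.
move=> gD gB x; rewrite [in LHS](tensor_pureE x) /tlift.
have g0 : g 0 = 0 by apply: (addrI (g 0)); rewrite -gD !addr0.
by rewrite (big_morph g gD g0); apply: eq_bigr => p _; rewrite gB.
Qed.

End Lift.

End Tensor.

Section TopFree.
Variable K : fieldType.

(** A K[[h]]-module with a chosen isomorphism [tf_coord] onto W[[h]],
    W = [tf_base]. The choice matters only for the models of the completed
    tensor products and of h-adically convergent sums, up to canonical
    isomorphism. *)
Record tfmod := TFMod {
  tf_sort :> lmodType (hser K);
  tf_base : lmodType K;
  tf_coord : {linear tf_sort -> hser tf_base};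
  tf_ofcoord : hser tf_base -> tf_sort;
  tf_coordK : cancel tf_coord tf_ofcoord;
  tf_ofcoordK : cancel tf_ofcoord tf_coord }.

Definition tf_series (W : lmodType K) : tfmod :=
  @TFMod (hser W) W idfun id (fun=> erefl) (fun=> erefl).

(** The [n]-th coefficient of an element of V = W[[h]]. *)
Definition tfc (V : tfmod) (v : V) (n : nat) : tf_base V :=
  hcoef (tf_coord V v) n.

(** The element of W, seen in V = W[[h]]. *)
Definition tf_const (V : tfmod) (w : tf_base V) : V :=
  tf_ofcoord (hconst w).

Definition hpow_sub (V : tfmod) (M : nat) : set V :=
  [set hvar ^+ M *: v | v in [set: V]].

(** U[[h]] (x) W[[h]] := (U (x) W)[[h]]. *)
Definition ctens (V U : tfmod) : tfmod :=
  tf_series (tensor (tf_base V) (tf_base U)).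

Definition ptens (V U : tfmod) (a : V) (b : U) : ctens V U :=
  HSer (fun n => \sum_(i < n.+1) pure (tfc a i) (tfc b (n - i)%N)).

(** The K[[h]]-linear map f (x) g, for K[[h]]-linear f and g: computed on
    W (x) W' through the universal property, then extended K[[h]]-linearly and
    h-adically continuously. It is characterized by [tmap_linear] and [tmap_ptens] below. *)
Definition tmap (V U V' U' : tfmod) (f : V -> V') (g : U -> U')
    (x : ctens V U) : ctens V' U' :=
  let F := tlift (fun w u => ptens (f (tf_const w)) (g (tf_const u))) in
  HSer (fun n => \sum_(i < n.+1) hcoef (F (tfc x i)) (n - i)%N).

Lemma tfcP (V : tfmod) (a b : V) : (forall n, tfc a n = tfc b n) -> a = b.
Proof. by move=> ab; apply: (can_inj (@tf_coordK V)); apply: hserP. Qed.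

Lemma tfcD (V : tfmod) (a b : V) n : tfc (a + b) n = tfc a n + tfc b n.
Proof. by rewrite /tfc linearD. Qed.

Lemma tfcN (V : tfmod) (a : V) n : tfc (- a) n = - tfc a n.
Proof. by rewrite /tfc linearN. Qed.

Lemma tfcZ (V : tfmod) (c : hser K) (a : V) n :
  tfc (c *: a) n = \sum_(i < n.+1) hcoef c i *: tfc a (n - i)%N.
Proof. by rewrite /tfc linearZ. Qed.

Lemma tfc_sum (V : tfmod) I (r : seq I) (P : pred I) (F : I -> V) n :
  tfc (\sum_(i <- r | P i) F i) n = \sum_(i <- r | P i) tfc (F i) n.
Proof. by rewrite /tfc linear_sum hcoef_sum. Qed.

Lemma tfc_of (V : tfmod) (x : hser (tf_base V)) n :
  tfc (tf_ofcoord x : V) n = hcoef x n.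
Proof. by rewrite /tfc tf_ofcoordK. Qed.

Lemma hcoefX (m n : nat) : hcoef (hvar ^+ m : hser K) n = (n == m)%:R.
Proof.
elim: m n => [|m IHm] n; first by rewrite expr0; case: n.
rewrite exprS; case: n => [|n]; first by rewrite /= big_ord1 mul0r.
rewrite /= big_ord_recl mul0r add0r big_ord_recl /= mul1r subn1 IHm /=.
rewrite big1 ?addr0 // => i _; by rewrite mul0r.
Qed.

Lemma tfcX (V : tfmod) (a : V) m n :
  tfc (hvar ^+ m *: a) n = if (m <= n)%N then tfc a (n - m)%N else 0.
Proof.
rewrite tfcZ; case: leqP => [le_mn | lt_nm].
  have lt_m : (m < n.+1)%N by [].
  rewrite (bigD1 (Ordinal lt_m)) //= hcoefX eqxx scale1r big1 ?addr0 // => i.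
  by rewrite -val_eqE /= hcoefX => /negPf ->; rewrite scale0r.
rewrite big1 // => i _; rewrite hcoefX; case: eqP => [im|]; rewrite ?scale0r //.
by have := ltn_ord i; rewrite im ltnS leqNgt lt_nm.
Qed.

Lemma hcoef_hX (W : lmodType K) (x : hser W) m n :
  hcoef (hvar ^+ m *: x) n = if (m <= n)%N then hcoef x (n - m)%N else 0.
Proof. exact: (@tfcX (tf_series W)). Qed.

Lemma hpow_subP (V : tfmod) M (v : V) :
  hpow_sub M v <-> forall n, (n < M)%N -> tfc v n = 0.
Proof.
split=> [[u _ <-] n lt_nM | v0]; first by rewrite tfcX leqNgt lt_nM.
exists (tf_ofcoord (HSer (fun n => tfc v (n + M)))) => //.
apply: tfcP => n; rewrite tfcX; case: leqP => [le_Mn | /v0 //].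
by rewrite tfc_of /= subnK.
Qed.

Lemma tf_expand (V : tfmod) (a : V) M : exists r : V,
  a = \sum_(i < M) hvar ^+ i *: tf_const (tfc a i) + hvar ^+ M *: r.
Proof.
pose d := a - \sum_(i < M) hvar ^+ i *: tf_const (tfc a i).
suff /hpow_subP[r _ rE] : forall n, (n < M)%N -> tfc d n = 0.
  by exists r; rewrite rE addrC subrK.
move=> n lt_nM; rewrite tfcD tfcN tfc_sum (bigD1 (Ordinal lt_nM)) //=.
rewrite tfcX leqnn tfc_of subnn /= big1 ?addr0 ?subrr // => i.
rewrite -val_eqE /= => ne_in; rewrite tfcX tfc_of; case: leqP => // le_in.
have : (0 < n - i)%N by rewrite subn_gt0 ltn_neqAle ne_in.
by case: (n - i)%N.
Qed.

Section Ptens.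
Variables V U : tfmod.
Implicit Types (a : V) (b : U).

Lemma hcoef_ptens a b n : hcoef (ptens a b) n =
  \sum_(i < n.+1) pure (tfc a i) (tfc b (n - i)%N).
Proof. by []. Qed.

Lemma ptensDl a a' b : ptens (a + a') b = ptens a b + ptens a' b.
Proof.
apply: hserP => n; rewrite hcoefD !hcoef_ptens -big_split.
by apply: eq_bigr => i _; rewrite tfcD pureDl.
Qed.

Lemma ptensDr a b b' : ptens a (b + b') = ptens a b + ptens a b'.
Proof.
apply: hserP => n; rewrite hcoefD !hcoef_ptens -big_split.
by apply: eq_bigr => i _; rewrite tfcD pureDr.
Qed.

Lemma pure_suml I (r : seq I) (F : I -> tf_base V) (u : tf_base U) :
  pure (\sum_(i <- r) F i) u = \sum_(i <- r) pure (F i) u.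
Proof.
apply: (big_morph (fun w => pure w u)) => [w w'|]; first exact: pureDl.
by rewrite -(scale0r 0) pureZl scale0r.
Qed.

Lemma pure_sumr I (r : seq I) (F : I -> tf_base U) (w : tf_base V) :
  pure w (\sum_(i <- r) F i) = \sum_(i <- r) pure w (F i).
Proof.
apply: (big_morph (fun u => pure w u)) => [u u'|]; first exact: pureDr.
by rewrite -(scale0r 0) pureZr scale0r.
Qed.

Lemma ptensZl c a b : ptens (c *: a) b = c *: ptens a b.
Proof.
apply: hserP => n; rewrite hcoefZ hcoef_ptens.
under eq_bigr => i _ do rewrite tfcZ pure_suml.
under [RHS]eq_bigr => i _ do rewrite hcoef_ptens scaler_sumr.
rewrite (sum_triangle (fun i j k => pure (hcoef c i *: tfc a j) (tfc b k))).
by apply: eq_bigr => i _; apply: eq_bigr => j _; rewrite pureZl.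
Qed.

Lemma ptensZr c a b : ptens a (c *: b) = c *: ptens a b.
Proof.
apply: hserP => n; rewrite hcoefZ hcoef_ptens.
under eq_bigr => i _ do rewrite tfcZ pure_sumr.
under [RHS]eq_bigr => i _ do rewrite hcoef_ptens scaler_sumr.
rewrite -(sum_triangle (fun i j k => pure (tfc a i) (hcoef c j *: tfc b k))).
rewrite -(sum_triangle (fun i j k => hcoef c i *: pure (tfc a j) (tfc b k))).
apply: eq_bigr => i _; rewrite (reindex_inj rev_ord_inj) /=.
by apply: eq_bigr => j _; rewrite subSS subKn -1?ltnS // pureZr.
Qed.

Lemma ptens_suml I (r : seq I) (F : I -> V) b :
  ptens (\sum_(i <- r) F i) b = \sum_(i <- r) ptens (F i) b.
Proof.
apply: (big_morph (fun a => ptens a b)) => [a a'|]; first exact: ptensDl.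
by rewrite -(scale0r 0) ptensZl scale0r.
Qed.

Lemma ptens_sumr I (r : seq I) (F : I -> U) a :
  ptens a (\sum_(i <- r) F i) = \sum_(i <- r) ptens a (F i).
Proof.
apply: (big_morph (fun b => ptens a b)) => [b b'|]; first exact: ptensDr.
by rewrite -(scale0r 0) ptensZr scale0r.
Qed.

End Ptens.

Section Tmap.
Variables (V U V' U' : tfmod) (f : {linear V -> V'}) (g : {linear U -> U'}).

Let B w u := ptens (f (tf_const w)) (g (tf_const u)).

Lemma tf_constD (X : tfmod) (w w' : tf_base X) :
  tf_const (w + w') = tf_const w + tf_const w'.
Proof. by apply: tfcP => -[|n]; rewrite tfcD !tfc_of //= addr0. Qed.

Lemma tf_constZ (X : tfmod) k (w : tf_base X) :
  tf_const (k *: w) = hconst k *: tf_const w.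
Proof.
apply: tfcP => n; rewrite tfcZ tfc_of big_ord_recl /= subn0 tfc_of.
rewrite big1 ?addr0 => [|i _]; last by rewrite scale0r.
by case: n => //=; rewrite scaler0.
Qed.

Lemma tmap_balanced : balanced B.
Proof.
split=> *; rewrite /B ?tf_constD ?tf_constZ ?linearD ?ptensDl ?ptensDr //.
by rewrite !linearZ ptensZl ptensZr.
Qed.

Lemma tmap_ptens a b : tmap f g (ptens a b) = ptens (f a) (g b).
Proof.
have balB := tmap_balanced; pose F := tlift B.
have F0 : F 0 = 0 by apply: (addrI (F 0)); rewrite -tliftD // !addr0.
have Fsum I (r : seq I) (G : I -> tensor (tf_base V) (tf_base U)) :
    F (\sum_(i <- r) G i) = \sum_(i <- r) F (G i).
  by apply: (big_morph F) => // x y; apply: tliftD.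
apply: hserP => n; rewrite /tmap -/B -/F.
transitivity (\sum_(i < n.+1) \sum_(j < i.+1)
    hcoef (B (tfc a j) (tfc b (i - j)%N)) (n - i)%N).
  apply: eq_bigr => i _.
  rewrite -[tfc _ i]/(hcoef (ptens a b) i) hcoef_ptens Fsum hcoef_sum.
  by apply: eq_bigr => j _; rewrite /F tlift_pure.
rewrite (sum_triangle (fun i j k => hcoef (B (tfc a i) (tfc b j)) k)).
have ptens_hl x r y :
    hcoef (ptens (x + hvar ^+ n.+1 *: r : V') (y : U')) n = hcoef (ptens x y) n.
  by rewrite ptensDl ptensZl hcoefD hcoef_hX ltnn addr0.
have ptens_hr x y r :
    hcoef (ptens (x : V') (y + hvar ^+ n.+1 *: r : U')) n = hcoef (ptens x y) n.
  by rewrite ptensDr ptensZr hcoefD hcoef_hX ltnn addr0.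
have fZ c x : f (c *: x) = c *: f x by rewrite linearZ.
have gZ c x : g (c *: x) = c *: g x by rewrite linearZ.
have [r aE] := tf_expand a n.+1; have [s bE] := tf_expand b n.+1.
rewrite [in RHS]aE [in RHS]bE !linearD fZ gZ ptens_hl ptens_hr !linear_sum.
rewrite ptens_suml hcoef_sum; apply: eq_bigr => i _.
rewrite fZ ptensZl hcoef_hX -ltnS ltn_ord.
rewrite ptens_sumr hcoef_sum.
rewrite (big_ord_widen n.+1
  (fun k => hcoef (B (tfc a i) (tfc b k)) (n - i - k)%N)); last first.
  by rewrite ltnS leq_subr.
rewrite big_mkcond; apply: eq_bigr => j _.
by rewrite gZ ptensZr hcoef_hX ltnS.
Qed.

Lemma tmap_linear : linear (tmap f g).
Proof.
have balB := tmap_balanced; pose F := tlift B.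
have FZ k x n : hcoef (F (k *: x)) n = k *: hcoef (F x) n.
  rewrite [x]tensor_pureE; elim: (repr x) => [|[w u] s IHs].
    rewrite big_nil scaler0 (_ : F 0 = 0) ?hcoef0 ?scaler0 //.
    by apply: (addrI (F 0)); rewrite -tliftD // !addr0.
  rewrite big_cons scalerDr /F !tliftD // !hcoefD scalerDr -/F IHs -pureZl.
  congr (_ + _); rewrite /F !tlift_pure // /B tf_constZ linearZ ptensZl hcoefZ.
  by rewrite big_ord_recl subn0 big1 ?addr0 // => i _; rewrite scale0r.
move=> c x y; apply: hserP => n; rewrite hcoefD hcoefZ /tmap -/B -/F.
rewrite -[X in _ = _ + X]/(\sum_(i < n.+1) hcoef (F (tfc y i)) (n - i)).
transitivity (\sum_(i < n.+1) \sum_(j < i.+1)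
    hcoef c j *: hcoef (F (tfc x (i - j)%N)) (n - i)
    + \sum_(i < n.+1) hcoef (F (tfc y i)) (n - i)); last first.
  rewrite (sum_triangle (fun i j k => hcoef c i *: hcoef (F (tfc x j)) k)).
  by congr (_ + _); apply: eq_bigr => i _; rewrite scaler_sumr.
rewrite -big_split; apply: eq_bigr => i _; rewrite tfcD /F tliftD // -/F hcoefD.
congr (_ + _); rewrite tfcZ (big_morph F (id1 := 0) (op1 := +%R)).
- by rewrite hcoef_sum; apply: eq_bigr => j _; rewrite FZ.
- by move=> s t; apply: tliftD.
- by apply: (addrI (F 0)); rewrite -tliftD // !addr0.
Qed.

End Tmap.

End TopFree.

Section Laurent.
Variable K : fieldType.

Definition laurent_pred : {pred int -> K^o} :=
  fun f => `[< exists N : int, forall n, (n < N)%R -> f n = 0 >].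

(** K((z)); [lcoef f n] is the coefficient of z^n. *)
Record laurent := Laurent {
  lcoef :> int -> K^o;
  lcoefP : lcoef \in laurent_pred }.

HB.instance Definition _ := [isSub for lcoef].
HB.instance Definition _ := [Choice of laurent by <:].

Lemma laurent_submod : submod_closed laurent_pred.
Proof.
split=> [|k f g /asboolP[M fM] /asboolP[N gN]].
  by apply/asboolP; exists 0.
apply/asboolP; exists (Order.min M N) => n; rewrite lt_min.
by case/andP => /fM fn /gN gn; rewrite -[LHS]/(k *: f n + g n) fn gn scaler0 addr0.
Qed.
HB.instance Definition _ :=
  GRing.isSubmodClosed.Build K (int -> K^o) laurent_pred laurent_submod.
HB.instance Definition _ := [SubChoice_isSubLmodule of laurent by <:].

Lemma lone_subproof :
  (fun n : int => (n == 0)%:R : K^o) \in laurent_pred.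
Proof. by apply/asboolP; exists 0 => n; case: eqP => // ->. Qed.
Definition lone : laurent := Laurent lone_subproof.

Lemma lshift_subproof (m : int) (f : laurent) :
  (fun n : int => lcoef f (n - m)) \in laurent_pred.
Proof.
case: f => f /= /asboolP[N fN]; apply/asboolP; exists (N + m) => n nN.
by apply: fN; rewrite ltrBlDr.
Qed.
(** z^m f(z). *)
Definition lshift (m : int) (f : laurent) : laurent :=
  Laurent (lshift_subproof m f).

(** K((z))[[h]], its element 1, multiplication by z^m and the element z^m. *)
Definition hlaurent := tf_series laurent.
Definition hlone : hlaurent := hconst lone.
Definition zmul (m : int) (f : hlaurent) : hlaurent :=
  HSer (fun i => lshift m (hcoef f i)).
Definition zpow (m : int) : hlaurent := zmul m hlone.

End Laurent.
Arguments hlone {K}.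
Arguments zpow {K} m.

Section Distributions.
Variables (K : fieldType) (V : tfmod K).

(** An element of V[[z, z^-1]] is a function [int -> V]: [y n] is the
    coefficient of z^n (not the mode [y_(n)], which is [y (- n - 1)]). *)

Definition kscale (c : K) (v : V) : V := hconst c *: v.

(** V_h((z)). *)
Definition hlaurent_dist : set (int -> V) :=
  [set y | forall M : nat, exists N : int,
     forall n : int, (n < N)%R -> hpow_sub M (y n)].

Definition dz (y : int -> V) : int -> V := fun n => y (n + 1) *~ (n + 1).

Definition Res (y : int -> V) : V := y (-1).

(** h-adically convergent sums: modulo each power of [h], only finitely many
    terms are nonzero. *)
Definition hsum (I : choiceType) (F : I -> V) : V :=
  tf_ofcoord (HSer (fun M => \sum_(i \in [set: I]) tfc (F i) M)).

(** The product f(z) y(z) in V_h((z)), for f in K((z))[[h]] and y in V_h((z));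
    f = sum of the h^i (f_i)_p z^p. *)
Definition fmul (f : hlaurent K) (y : int -> V) : int -> V := fun n =>
  hsum (fun ip : nat * int =>
    hvar ^+ ip.1 *: kscale (lcoef (hcoef f ip.1) ip.2) (y (n - ip.2))).

Lemma fmul_term f y (n : int) (M : nat) (ip : nat * int) :
  tfc (hvar ^+ ip.1 *: kscale (lcoef (hcoef f ip.1) ip.2) (y (n - ip.2))) M
  = if (ip.1 <= M)%N
    then lcoef (hcoef f ip.1) ip.2 *: tfc (y (n - ip.2)) (M - ip.1)%N else 0.
Proof.
rewrite tfcX /kscale; case: leqP => // _; rewrite tfcZ big_ord_recl /= subn0.
by rewrite big1 ?addr0 // => i _; rewrite scale0r.
Qed.

(** For f in K((z))[[h]] and y in V_h((z)), the sum defining the coefficients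
    of f(z) y(z) converges and f(z) y(z) is in V_h((z)). *)
Lemma fmul_bound f y (M : nat) : hlaurent_dist y -> exists L N : int,
  forall (n : int) (ip : nat * int), tfc (hvar ^+ ip.1 *:
      kscale (lcoef (hcoef f ip.1) ip.2) (y (n - ip.2))) M != 0 ->
    [/\ (ip.1 <= M)%N, (L <= ip.2)%R & (N <= n - ip.2)%R].
Proof.
move=> /(_ M.+1)[N yN].
have [L fL] : exists L : int, forall i p,
    (i <= M)%N -> (p < L)%R -> lcoef (hcoef f i) p = 0.
  elim: M {yN} => [|M [L fL]].
    have /asboolP[L fL] := lcoefP (hcoef f 0); exists L => i p.
    by rewrite leqn0 => /eqP ->; apply: fL.
  have /asboolP[L' fL'] := lcoefP (hcoef f M.+1); exists (Order.min L L').
  move=> i p; rewrite lt_min leq_eqVlt => /orP[/eqP -> | iM] /andP[pL pL'].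
    exact: fL'.
  exact: fL.
exists L, N => n ip; rewrite fmul_term; case: leqP => [iM|]; last by rewrite eqxx.
case: (ltP ip.2 L) => [pL | Lp]; first by rewrite fL // scale0r eqxx.
case: (ltP (n - ip.2) N) => // /yN/hpow_subP y0.
by rewrite y0 ?scaler0 ?eqxx // ltnS leq_subr.
Qed.

Lemma fmul_finite f y (n : int) (M : nat) : hlaurent_dist y ->
  finite_set [set ip | tfc (hvar ^+ ip.1 *:
    kscale (lcoef (hcoef f ip.1) ip.2) (y (n - ip.2))) M != 0].
Proof.
move=> /(fmul_bound f M)[L [N LN]].
pose g (x : nat * nat) : nat * int := (x.1, L + x.2%:Z).
have gfin := finite_image g
  (finite_setX (finite_II M.+1) (finite_II (absz (n - N - L)%R).+1)).
refine (sub_finite_set _ gfin).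
move=> [i p] Hip; have [/= iM Lp Np] := LN _ _ Hip; exists (i, absz (p - L)%R) => /=.
  by split=> //=; move: Lp Np; lia.
by rewrite /g /=; congr pair; move: Lp; lia.
Qed.

Lemma fmul_laurent f y : hlaurent_dist y -> hlaurent_dist (fmul f y).
Proof.
move=> yV M.
have [B yB] : exists B : int, forall m (n : int) ip, (m < M)%N -> (n < B)%R ->
    tfc (hvar ^+ ip.1 *:
      kscale (lcoef (hcoef f ip.1) ip.2) (y (n - ip.2))) m = 0.
  elim: M => [|M [B IHM]]; first by exists 0.
  have [L [N LN]] := fmul_bound f M yV; exists (Order.min B (L + N)) => m n ip.
  rewrite lt_min ltnS leq_eqVlt => /orP[/eqP -> | mM] /andP[nB nLN].
    by apply: contraTeq nLN => /LN[_]; lia.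
  exact: IHM.
exists B => n nB; apply/hpow_subP => m mM.
by rewrite tfc_of /= fsbig1 // => ip _; apply: yB.
Qed.

(** Power series in [lambda] with coefficients in V: [p n] is the coefficient
    of lambda^n. The completed V[lambda] consists of those that are polynomial
    modulo each h^M. *)
Definition lambda_poly : set (nat -> V) :=
  [set p | forall M : nat, exists N : nat,
     forall n : nat, (N <= n)%N -> hpow_sub M (p n)].

Definition dlambda (p : nat -> V) : nat -> V := fun n => p n.+1 *+ n.+1.

Definition lconst (v : V) : nat -> V := fun n => if n is 0 then v else 0.

Definition lambda_plus (T : V -> V) (p : nat -> V) : nat -> V :=
  fun n => (if n is n'.+1 then p n' else 0) + T (p n).

(** X^(n) = X^n / n! for an operator X on series in [lambda]. *)
Definition divided_power (X : (nat -> V) -> (nat -> V)) (n : nat)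
    (p : nat -> V) : nat -> V :=
  fun j => kscale (n`!%:R^-1) (iter n X p j).

(** The coefficient of lambda^n in e^{lambda z} y(z). *)
Definition exp_mul (y : int -> V) (n : nat) : int -> V :=
  fun m => kscale (n`!%:R^-1) (y (m - n%:Z)).

End Distributions.

Record braided_sfc (K : fieldType) (V : tfmod K) := BraidedSFC {
  vac : V;
  transl : {linear V -> V};
  Yz : {linear ctens V V -> (int -> V)};
  braiding : {linear ctens V V -> ctens (ctens V V) (hlaurent K)};
  vac_neq0 : vac <> 0;
  transl_vac : transl vac = 0;
  Yz_laurent : forall x, hlaurent_dist (Yz x);
  Yz_vacl : forall v n, Yz (ptens vac v) n = if n == 0 then v else 0;
  Yz_vacr : forall v, Yz (ptens v vac) 0 = v /\
    forall n : int, (n < 0)%R -> Yz (ptens v vac) n = 0;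
  Yz_translr : forall x,
    dz (Yz x) = fun n => transl (Yz x n) - Yz (tmap idfun transl x) n;
  Yz_transll : forall x, dz (Yz x) = Yz (tmap transl idfun x);
  braiding_mod_h : forall x,
    hpow_sub 1 (braiding x - ptens x hlone) }.

Section LambdaProduct.
Variables (K : fieldType) (V : tfmod K) (X : braided_sfc V).

(** a_(lambda, f) b = Res_z e^{lambda z} f(z) Y(z)(a (x) b). *)
Definition lprod (f : hlaurent K) (a b : V) : nat -> V :=
  fun n => Res (exp_mul (fmul f (Yz X (ptens a b))) n).

Lemma lprod_poly f a b : lambda_poly (lprod f a b).
Proof.
move=> M; have [N yN] := fmul_laurent f (Yz_laurent X (ptens a b)) M.
exists (absz N) => n Nn; have [|v _ vE] := yN (-1 - n%:Z); first by lia.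
exists (hconst (n`!%:R^-1) *: v) => //.
by rewrite /lprod /Res /exp_mul /kscale -vE !scalerA mulrC.
Qed.

(** Its extension in [a], linear over polynomials in [lambda]:
    p_(lambda, f) b = sum over j of lambda^j (p_j)_(lambda, f) b. *)
Definition lprod_ext (f : hlaurent K) (p : nat -> V) (b : V) : nat -> V :=
  fun n => \sum_(j < n.+1) lprod f (p j) b (n - j)%N.

End LambdaProduct.

(* Main.v *)
(** Multiplication by [z^m] shifts coefficients, and the coefficients of
    [e^{lambda z}] are the inverse factorials, which gives (a).  For (b), taking
    the residue of the derivative of [e^{lambda z} z^{-k} Y(z)(a (x) b)] gives
    [k a_(lambda, z^{-k-1}) b = ((lambda + T) a)_(lambda, z^{-k}) b], and this
    recursion in [k] extends to series in [lambda] in place of [a]. *)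

Require Import Defs.
From HB Require Import structures.
From mathcomp Require Import all_boot all_order all_algebra.
From mathcomp Require Import boolp classical_sets functions.
From mathcomp Require Import fsbigop zify.

Set Implicit Arguments.
Unset Strict Implicit.
Unset Printing Implicit Defensive.

Import GRing.Theory.
Local Open Scope ring_scope.

Section Hconst.
Variable R : comNzRingType.

(** As a ring morphism, [hconst] carries identities between scalars of K over to [kscale], which
    acts through K[[h]]. *)
Lemma hconst_zmod_morphism : zmod_morphism (@hconst R).
Proof. by move=> x y; apply: hserP => -[|n] //=; rewrite subr0. Qed.

Lemma hconst_monoid_morphism : monoid_morphism (@hconst R).
Proof.
split=> // x y; apply: hserP => n /=.
rewrite big_ord_recl subn0 big1 ?addr0 => [|i _]; last by rewrite mul0r.
by case: n => //=; rewrite mulr0.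
Qed.

HB.instance Definition _ :=
  GRing.isZmodMorphism.Build R (hser R) (@hconst R) hconst_zmod_morphism.
HB.instance Definition _ :=
  GRing.isMonoidMorphism.Build R (hser R) (@hconst R) hconst_monoid_morphism.

End Hconst.

Section Kscale.
Variables (K : fieldType) (V : tfmod K).
Implicit Types (c d : K) (v w : V).

Lemma kscaleA c d v : kscale c (kscale d v) = kscale (c * d) v.
Proof. by rewrite /kscale scalerA rmorphM. Qed.

Lemma kscale1 v : kscale 1 v = v.
Proof. by rewrite /kscale rmorph1 scale1r. Qed.

Lemma kscaleDl c d v : kscale (c + d) v = kscale c v + kscale d v.
Proof. by rewrite /kscale rmorphD scalerDl. Qed.

Lemma kscaleDr c v w : kscale c (v + w) = kscale c v + kscale c w.
Proof. exact: scalerDr. Qed.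

Lemma kscale_sumr I (r : seq I) (F : I -> V) c :
  kscale c (\sum_(i <- r) F i) = \sum_(i <- r) kscale c (F i).
Proof. exact: scaler_sumr. Qed.

Lemma kscale_nat n v : kscale n%:R v = v *+ n.
Proof. by rewrite /kscale rmorph_nat scaler_nat. Qed.

Lemma kscale_int (m : int) v : kscale m%:~R v = v *~ m.
Proof. by rewrite /kscale rmorph_int scaler_int. Qed.

End Kscale.

Section Shift.
Variables (K : fieldType) (V : tfmod K).
Implicit Types (f : hlaurent K) (y : int -> V).

Lemma fmul_zmul (m : int) f y (n : int) :
  fmul (zmul m f) y n = fmul f y (n - m).
Proof.
congr (tf_ofcoord _); apply: hserP => M /=.
(* Shifting the z-exponent is a bijection of the index set, so the sums agree even when they do not
   converge, both then being the default 0. *)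
pose s (ip : nat * int) := (ip.1, ip.2 + m).
rewrite (reindex_fsbigT s) /=; last first.
  by exists (fun ip => (ip.1, ip.2 - m)) => -[i p]; rewrite /s /= ?addrK ?subrK.
apply: eq_fsbigr => -[i p] _ /=; rewrite addrK.
by congr (tfc (_ *: kscale _ (y _)) M); lia.
Qed.

Lemma fmul_hlone y (n : int) : fmul hlone y n = y n.
Proof.
apply: tfcP => M; rewrite tfc_of /=.
(* The series 1 has its only nonzero coefficient at h^0 z^0. *)
rewrite -(fsbig_widen [set (0%N, 0)]) //=.
  by rewrite fsbig_set1 expr0 scale1r subr0 kscale1.
move=> [i p] [_ ne] /=; rewrite /kscale.
suff -> : lcoef (hcoef (hlone : hlaurent K) i) p = 0.
  by rewrite rmorph0 scale0r scaler0 /tfc linear0.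
by case: i ne => [|i] //= ne; case: eqP => // p0; case: ne; rewrite p0.
Qed.

Lemma fmul_zpow (m : int) y (n : int) : fmul (zpow m) y n = y (n - m).
Proof. by rewrite /zpow fmul_zmul fmul_hlone. Qed.

End Shift.

Section LambdaCalculus.
Variables (K : fieldType) (charK : [pchar K] =i pred0).
Variables (V : tfmod K) (X : braided_sfc V).
Implicit Types (a b : V) (f : hlaurent K) (p : nat -> V).

Lemma lprodE f a b n :
  lprod X f a b n = kscale (n`!%:R^-1) (fmul f (Yz X (ptens a b)) (- 1 - n%:Z)).
Proof. by []. Qed.

Lemma lprod_zpowE (m : int) a b n :
  lprod X (zpow m) a b n =
  kscale (n`!%:R^-1) (Yz X (ptens a b) (- 1 - n%:Z - m)).
Proof. by rewrite lprodE fmul_zpow. Qed.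

Lemma lprod_zpowD (m : int) a a' b n :
  lprod X (zpow m) (a + a') b n =
  lprod X (zpow m) a b n + lprod X (zpow m) a' b n.
Proof. by rewrite !lprod_zpowE ptensDl linearD kscaleDr. Qed.

Lemma lprod_zpowZ (m : int) c a b n :
  lprod X (zpow m) (kscale c a) b n = kscale c (lprod X (zpow m) a b n).
Proof.
rewrite !lprod_zpowE.
have -> : Yz X (ptens (kscale c a) b) = hconst c *: Yz X (ptens a b).
  by rewrite /kscale ptensZl linearZ.
(* Scalars act pointwise on functions [int -> V]. *)
by rewrite [X in kscale _ X]/(kscale c (Yz X (ptens a b) _)) !kscaleA mulrC.
Qed.

Lemma lprod_zpow0 (m : int) b n : lprod X (zpow m) 0 b n = 0.
Proof.
by apply: (addrI (lprod X (zpow m) 0 b n)); rewrite -lprod_zpowD !addr0.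
Qed.

Lemma natr_neq0 n : n.+1%:R != 0 :> K.
Proof. by move/pcharf0P: charK => ->. Qed.

Lemma factr_neq0 n : n`!%:R != 0 :> K.
Proof. by move/pcharf0P: charK => ->; rewrite -lt0n fact_gt0. Qed.

Lemma invfactS n : n.+1%:R * n.+1`!%:R^-1 = n`!%:R^-1 :> K.
Proof. by rewrite factS natrM invfM mulVKf ?natr_neq0. Qed.

(** Differentiating e^{lambda z} in lambda brings down a factor z; on coefficients, n+1 cancels
    against (n+1)! in characteristic zero. *)
Lemma dlambda_lprod f a b :
  dlambda (lprod X f a b) = lprod X (zmul 1 f) a b.
Proof.
apply/funext => n; rewrite /dlambda !lprodE fmul_zmul -kscale_nat kscaleA invfactS.
by congr (kscale _ (fmul _ _ _)); lia.
Qed.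

Lemma zmulD (m n : int) f : zmul m (zmul n f) = zmul (m + n) f.
Proof.
apply: hserP => i /=; apply: val_inj; apply/funext => k /=.
by rewrite opprD addrA.
Qed.

Lemma zmul0 f : zmul 0 f = f.
Proof.
by apply: hserP => i /=; apply: val_inj; apply/funext => k /=; rewrite subr0.
Qed.

Lemma lprod_zmul (m : nat) f a b :
  lprod X (zmul m%:Z f) a b = iter m (@dlambda K V) (lprod X f a b).
Proof.
elim: m => [|m IHm]; first by rewrite zmul0.
by rewrite iterS -IHm dlambda_lprod zmulD.
Qed.

Lemma Yz_transl a b (n : int) :
  Yz X (ptens (transl X a) b) n = Yz X (ptens a b) (n + 1) *~ (n + 1).
Proof.
have := Yz_transll X (ptens a b).
by rewrite (tmap_ptens (transl X) idfun) => <-.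
Qed.

(** The [match] is the lambda^n coefficient of lambda times the product. All three terms are
    multiples of the coefficient of z^(k-n) in Y(a,z)b, with factors n/n!, (k-n)/n! and k/n!. *)
Lemma lprod_transl (k : nat) a b n :
  (if n is n'.+1 then lprod X (zpow (- k%:Z)) a b n' else 0)
    + lprod X (zpow (- k%:Z)) (transl X a) b n
  = lprod X (zpow (- k.+1%:Z)) a b n *+ k.
Proof.
rewrite !lprod_zpowE Yz_transl -kscale_int -kscale_nat !kscaleA.
have -> : - 1 - n%:Z - - k.+1%:Z = k%:Z - n%:Z by lia.
have -> : - 1 - n%:Z - - k%:Z + 1 = k%:Z - n%:Z by lia.
rewrite intrB mulrBr; case: n => [|n].
  by rewrite mulr0 add0r subr0 mulrC.
rewrite lprod_zpowE -(invfactS n).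
have -> : - 1 - n%:Z - - k%:Z = k%:Z - n.+1%:Z by lia.
by rewrite -kscaleDl [n.+1%:R * _]mulrC addrC subrK mulrC.
Qed.

(** Applying [lprod_transl] to each coefficient of [p] gives a recursion that can be iterated, as
    (lambda + T)a already involves lambda. *)
Lemma lprod_ext_lambda_plus (k : nat) p b n :
  lprod_ext X (zpow (- k%:Z)) (lambda_plus (transl X) p) b n
  = lprod_ext X (zpow (- k.+1%:Z)) p b n *+ k.
Proof.
rewrite /lprod_ext /lambda_plus -sumrMnl.
under eq_bigr do rewrite lprod_zpowD.
under [RHS]eq_bigr do rewrite -lprod_transl.
rewrite !big_split; congr (_ + _) => /=.
(* Lambda times [p] has no constant term, so the left sum loses j = 0; lambda times a product has
   none either, so the right sum loses j = n. The rest match after shifting j by one. *)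
rewrite big_ord_recl lprod_zpow0 add0r big_ord_recr /= subnn addr0.
apply: eq_bigr => i _; rewrite add0n /bump leq0n add1n subnS.
by have := ltn_ord i; rewrite -subn_gt0; case: (n - i)%N.
Qed.

Lemma lprod_ext_iter (k : nat) p b n :
  lprod_ext X (zpow (- 1%:Z)) (iter k (lambda_plus (transl X)) p) b n
  = lprod_ext X (zpow (- k.+1%:Z)) p b n *+ k`!.
Proof.
elim: k p => [|k IHk] p //.
(* The innermost factor is peeled off, with [p] general; the pole orders 1, ..., k met on the way
   multiply to k!. *)
by rewrite iterSr IHk lprod_ext_lambda_plus -mulrnA factS.
Qed.

Lemma lprod_ext_divided_power (k : nat) p b :
  lprod_ext X (zpow (- 1%:Z)) (divided_power (lambda_plus (transl X)) k p) b
  = lprod_ext X (zpow (- k.+1%:Z)) p b.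
Proof.
apply/funext => n; rewrite {1}/lprod_ext /divided_power.
under eq_bigr do rewrite lprod_zpowZ.
rewrite -kscale_sumr -[X in kscale _ X]/(lprod_ext X _ _ b n) lprod_ext_iter.
(* The divided power cancels k!, invertible in characteristic zero. *)
by rewrite -kscale_nat kscaleA mulVf ?factr_neq0 // kscale1.
Qed.

Lemma lprod_ext_lconst (m : int) a b :
  lprod_ext X (zpow m) (lconst a) b = lprod X (zpow m) a b.
Proof.
apply/funext => n; rewrite /lprod_ext big_ord_recl subn0 big1 ?addr0 // => i _.
exact: lprod_zpow0.
Qed.

End LambdaCalculus.

Theorem lemma5 (K : fieldType) (charK : [pchar K] =i pred0)
    (V : tfmod K) (X : braided_sfc V) (a b : V) :
  [/\ forall (m : nat) (f : hlaurent K),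
        lprod X (zmul m%:Z f) a b = iter m (@dlambda K V) (lprod X f a b),
      forall m : nat,
        lprod X (zpow m%:Z) a b = iter m (@dlambda K V) (lprod X hlone a b)
    & forall k : nat, (1 <= k)%N ->
        lprod X (zpow (- k%:Z)) a b
        = lprod_ext X (zpow (- 1%:Z))
            (divided_power (lambda_plus (transl X)) k.-1 (lconst a)) b].
Proof.
(* The second claim is the first at f = 1, since [zpow] unfolds to [zmul] of [hlone]. *)
split=> [m f | m | [//|k] _]; [exact: lprod_zmul | exact: lprod_zmul |].
by rewrite lprod_ext_divided_power // lprod_ext_lconst.
Qed.
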